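(* Let $\mathcal{A}$ be an abelian category with enough projective objects and enough injective objects, let $(\mathcal{X},\mathcal{Y})$ be a GP-admissible pair in $\mathcal{A}$, and let $n$ be a non-negative integer. Then: (i) $\mathrm{gl.GPD}_{(\mathcal{X},\mathcal{Y})}(\mathcal{A})\leq n<\infty$ if and only if $\mathrm{pd}(\mathrm{Inj}(\mathcal{A}))\leq n$ and $\mathrm{id}(\mathcal{Y})<\infty$. (ii) $\mathrm{gl.GPD}_{(\mathcal{X},\mathcal{Y})}(\mathcal{A})=n$ if and only if $\mathrm{pd}(\mathrm{Inj}(\mathcal{A}))\leq n\leq \mathrm{id}(\mathcal{Y})<\infty$.
   Context: $\mathrm{Proj}(\mathcal{A})$ and $\mathrm{Inj}(\mathcal{A})$ are the classes of projective and injective objects of $\mathcal{A}$. For an object $M$, $\mathrm{pd}(M)$ is the least $n\ge 0$ with $\mathrm{Ext}^j_{\mathcal{A}}(M,-)=0$ for all $j>n$ ($\infty$ if there is none), and $\mathrm{id}(M)$ is the least $n\ge 0$ with $\mathrm{Ext}^j_{\mathcal{A}}(-,M)=0$ for all $j>n$ ($\infty$ if there is none). For a class $\mathcal{C}$, $\mathrm{pd}(\mathcal{C})=\sup\{\mathrm{pd}(C):C\in\mathcal{C}\}$ and $\mathrm{id}(\mathcal{C})=\sup\{\mathrm{id}(C):C\in\mathcal{C}\}$. Write $\mathcal{X}\perp\mathcal{Y}$ if $\mathrm{Ext}^i_{\mathcal{A}}(X,Y)=0$ for all $X\in\mathcal{X}$, $Y\in\mathcal{Y}$, $i>0$. A pair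 $(\mathcal{X},\mathcal{Y})$ of classes of objects of $\mathcal{A}$ is GP-admissible if: every $A\in\mathcal{A}$ admits an epimorphism $X\to A$ with $X\in\mathcal{X}$; $\mathcal{X}$ and $\mathcal{Y}$ are closed under finite coproducts and $\mathcal{X}$ is closed under extensions; for every $X\in\mathcal{X}$ there is a short exact sequence $0\to X\to W\to X'\to 0$ with $W\in\mathcal{X}\cap\mathcal{Y}$ and $X'\in\mathcal{X}$; and $\mathcal{X}\perp\mathcal{Y}$. Standing assumption: GP-admissible pairs also satisfy $\mathcal{X}\cap\mathcal{Y}=\mathrm{Proj}(\mathcal{A})$. An object $M$ is $(\mathcal{X},\mathcal{Y})$-Gorenstein projective if it is a cycle of an exact complex $X_\bullet$ (indexed by $\mathbb{Z}$) with all $X_m\in\mathcal{X}$ such that $\mathrm{Hom}_{\mathcal{A}}(X_\bullet,Y)$ is exact for all $Y\in\mathcal{Y}$; $\mathcal{GP}_{(\mathcal{X},\mathcal{Y})}$ is the class of these objects. $\mathrm{Gpd}_{(\mathcal{X},\mathcal{Y})}(M)$ is the least $n\ge 0$ for which there is an exact sequence $0\to G_n\to\cdots\to G_0\to M\to 0$ with all $G_i\in\mathcal{GP}_{(\mathcal{X},\mathcal{Y})}$ ($\infty$ if there is none), and $\mathrm{gl.GPD}_{(\mathcal{X},\mathcal{Y})}(\mathcal{A})=\sup\{\mathrm{Gpd}_{(\mathcal{X},\mathcal{Y})}(A):A\in\mathcal{A}\}$. *)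

(* Defs.v *)
From HB Require Import structures.
From mathcomp Require Import all_boot all_order all_algebra.
From mathcomp Require Import boolp classical_sets.

Set Implicit Arguments.
Unset Strict Implicit.
Unset Printing Implicit Defensive.

Import GRing.Theory.
Local Open Scope classical_set_scope.
Local Open Scope ring_scope.

Declare Scope enat_scope.
Delimit Scope enat_scope with enat.

Inductive enat := Fin of nat | Infty.

Definition ele (x y : enat) : Prop :=
  match x, y with
  | _, Infty => True
  | Infty, Fin _ => False
  | Fin m, Fin n => (m <= n)%N
  end.
Definition elt (x y : enat) : Prop := ele x y /\ x <> y.

Notation "x <= y" := (ele x y) : enat_scope.
Notation "x < y" := (elt x y) : enat_scope.

(* The least natural number in S, and infinity if S is empty. *)
Definition least (S : set nat) : enat :=
  match pselect (exists n, `[< S n >]) with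
  | left exS => Fin (ex_minn exS)
  | right _ => Infty
  end.

(* The least upper bound; the supremum of the empty set is Fin 0. *)
Definition esup (S : set enat) : enat :=
  least [set n | forall x, S x -> (x <= Fin n)%enat].

Declare Scope cat_scope.
Delimit Scope cat_scope with cat.

Record preadditive := Preadditive {
  obj :> Type;
  hom : obj -> obj -> zmodType;
  idm : forall a, hom a a;
  comp : forall a b c, hom b c -> hom a b -> hom a c;
  comp1m : forall a b (f : hom a b), comp (idm b) f = f;
  compm1 : forall a b (f : hom a b), comp f (idm a) = f;
  compA : forall a b c d (h : hom c d) (g : hom b c) (f : hom a b),
    comp h (comp g f) = comp (comp h g) f;
  compDl : forall a b c (g g' : hom b c) (f : hom a b),
    comp (g + g') f = comp g f + comp g' f;
  compDr : forall a b c (g : hom b c) (f f' : hom a b),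
    comp g (f + f') = comp g f + comp g f'
}.
Arguments idm {p} a.
Notation "g ∘ f" := (comp g f) (at level 40, left associativity) : cat_scope.
Local Open Scope cat_scope.

Section Category.
Variable C : preadditive.
Implicit Types a b c t : C.

Definition mono a b (f : hom a b) : Prop :=
  forall t (u v : hom t a), f ∘ u = f ∘ v -> u = v.

Definition epi a b (f : hom a b) : Prop :=
  forall t (u v : hom b t), u ∘ f = v ∘ f -> u = v.

Definition is_kernel k a b (i : hom k a) (f : hom a b) : Prop :=
  f ∘ i = 0 /\
  forall t (g : hom t a), f ∘ g = 0 -> exists! h : hom t k, i ∘ h = g.

Definition is_cokernel a b q (p : hom b q) (f : hom a b) : Prop :=
  p ∘ f = 0 /\
  forall t (g : hom b t), g ∘ f = 0 -> exists! h : hom q t, h ∘ p = g.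

Definition is_coproduct (I : finType) (F : I -> C) s
    (inj : forall i, hom (F i) s) : Prop :=
  forall t (f : forall i, hom (F i) t),
    exists! h : hom s t, forall i, h ∘ inj i = f i.

Definition is_zero z : Prop :=
  forall t, (forall f : hom z t, f = 0) /\ (forall f : hom t z, f = 0).

(* In a preadditive category finite coproducts are biproducts, and the empty
   one is a zero object. *)
Record abelian : Prop := Abelian {
  has_coproducts : forall (I : finType) (F : I -> C),
    exists s (inj : forall i, hom (F i) s), is_coproduct inj;
  has_kernels : forall a b (f : hom a b),
    exists k (i : hom k a), is_kernel i f;
  has_cokernels : forall a b (f : hom a b),
    exists q (p : hom b q), is_cokernel p f;
  mono_normal : forall a b (f : hom a b), mono f ->
    exists c (g : hom b c), is_kernel f g;
  epi_normal : forall a b (f : hom a b), epi f ->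
    exists c (g : hom c a), is_cokernel f g
}.

(* Exactness of a -> b -> c at b: the image of f is the kernel of g. *)
Definition exact a b c (f : hom a b) (g : hom b c) : Prop :=
  exists k (e : hom a k) (i : hom k b), [/\ epi e, is_kernel i g & f = i ∘ e].

Definition short_exact a b c (f : hom a b) (g : hom b c) : Prop :=
  [/\ mono f, exact f g & epi g].

Definition projective p : Prop :=
  forall a b (e : hom a b) (f : hom p b), epi e -> exists g : hom p a, e ∘ g = f.

Definition injective_object q : Prop :=
  forall a b (m : hom a b) (f : hom a q), mono m -> exists g : hom b q, g ∘ m = f.

Definition Proj : set C := [set p | projective p].
Definition Inj : set C := [set q | injective_object q].

Definition enough_projectives : Prop :=
  forall a, exists p (e : hom p a), Proj p /\ epi e.

Definition enough_injectives : Prop :=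
  forall a, exists q (m : hom a q), Inj q /\ mono m.

(* Exact sequences ... -> R_1 -> R_0 -> M -> 0. *)
Record resolution (M : C) := Resolution {
  res_obj :> nat -> C;
  res_d : forall i, hom (res_obj i.+1) (res_obj i);
  res_aug : hom (res_obj 0%N) M;
  res_aug_epi : epi res_aug;
  res_exact0 : exact (res_d 0%N) res_aug;
  res_exactS : forall i, exact (res_d i.+1) (res_d i)
}.

Section HomComplex.
Variables (M N : C) (P : resolution M).

Definition cocycle i (f : hom (P i) N) : Prop := f ∘ res_d P i = 0.

Definition coboundary i : hom (P i) N -> Prop :=
  match i with
  | 0%N => fun f => f = 0
  | k.+1 => fun f => exists g : hom (P k) N, f = g ∘ res_d P k
  end.

End HomComplex.

(* Ext^i(M, N) = 0, where Ext^i(-, N) is the i-th right derived functor of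
   Hom(-, N), i.e. the i-th cohomology of Hom(P, N) for a projective
   resolution P of M. This does not depend on P, and P exists when the
   category has enough projectives, which is assumed wherever this is used. *)
Definition Ext_eq0 i (M N : C) : Prop :=
  forall P : resolution M, (forall k, Proj (P k)) ->
    forall f : hom (P i) N, cocycle f -> coboundary f.

Definition pd (M : C) : enat :=
  least [set n | forall j, (n < j)%N -> forall N, Ext_eq0 j M N].

Definition id_ (M : C) : enat :=
  least [set n | forall j, (n < j)%N -> forall N, Ext_eq0 j N M].

Definition pd_class (S : set C) : enat := esup (pd @` S).
Definition id_class (S : set C) : enat := esup (id_ @` S).

Definition perp (X Y : set C) : Prop :=
  forall x y i, X x -> Y y -> (0 < i)%N -> Ext_eq0 i x y.

Definition closed_finite_coproducts (X : set C) : Prop :=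
  forall (I : finType) (F : I -> C) s (inj : forall i, hom (F i) s),
    is_coproduct inj -> (forall i, X (F i)) -> X s.

Definition closed_extensions (X : set C) : Prop :=
  forall a b c (f : hom a b) (g : hom b c),
    short_exact f g -> X a -> X c -> X b.

Record GP_admissible (X Y : set C) : Prop := GPAdmissible {
  adm_epi : forall a, exists x (e : hom x a), X x /\ epi e;
  adm_coprodX : closed_finite_coproducts X;
  adm_coprodY : closed_finite_coproducts Y;
  adm_extX : closed_extensions X;
  adm_cogen : forall x, X x -> exists w x' (f : hom x w) (g : hom w x'),
    [/\ short_exact f g, (X `&` Y) w & X x'];
  adm_perp : perp X Y;
  adm_Proj : X `&` Y = Proj
}.

(* Exact complexes indexed by the integers. The index is written 1 + m
   because 1 + Posz k is convertible to Posz k.+1. *)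
Record exact_complex := ExactComplex {
  cx_obj :> int -> C;
  cx_d : forall m : int, hom (cx_obj (1 + m)) (cx_obj m);
  cx_exact : forall m : int, exact (cx_d (1 + m)) (cx_d m)
}.

Definition is_cycle (M : C) (K : exact_complex) : Prop :=
  exists (m : int) (i : hom M (K (1 + m))), is_kernel i (cx_d K m).

(* Exactness of Hom(K, y); the other inclusion is automatic. *)
Definition hom_exact (K : exact_complex) (y : C) : Prop :=
  forall (m : int) (f : hom (K (1 + m)) y), f ∘ cx_d K (1 + m) = 0 ->
    exists g : hom (K m) y, f = g ∘ cx_d K m.

Definition GP (X Y : set C) : set C :=
  [set M | exists K : exact_complex,
    [/\ forall m, X (K m), forall y, Y y -> hom_exact K y & is_cycle M K]].

(* 0 -> G_n -> ... -> G_0 -> M -> 0 is a resolution with G_i = 0 for i > n. *)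
Definition Gpd (X Y : set C) (M : C) : enat :=
  least [set n | exists G : resolution M,
    (forall i, (i <= n)%N -> GP X Y (G i)) /\
    (forall i, (n < i)%N -> is_zero (G i))].

Definition glGPD (X Y : set C) : enat := esup (range (Gpd X Y)).

End Category.

Arguments Proj C : clear implicits.
Arguments Inj C : clear implicits.

(* Main.v *)
From mathcomp Require Import all_boot all_order all_algebra.
From mathcomp Require Import boolp classical_sets.
Require Import Defs.

Set Implicit Arguments.
Unset Strict Implicit.
Unset Printing Implicit Defensive.

Import GRing.Theory.
Local Open Scope ring_scope.
Local Open Scope cat_scope.

(** Three facts on the projective and injective dimensions give both
    equivalences.

    If every object has Gorenstein dimension at most [n], then [id Y <= n] and
    [pd Inj <= n] ([glGPD_bounds]). The first holds because Gorenstein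
    projective objects have no higher Ext into [Y], so that Ext into [Y] may be
    computed by shifting along Gorenstein projective resolutions. For the
    second, an object of Gorenstein dimension at most [n] embeds into an object
    of projective dimension at most [n] ([Gdim_hull]), and an injective object
    is a direct summand of anything it embeds into.

    If [pd Inj <= n] and [id Y] is finite, then every object has Gorenstein
    dimension at most [n] ([glGPD_le_pd]). Embedding [M] into an injective
    object with cokernel [Z] and passing to [n]-th syzygies embeds the syzygy of
    [M] into a projective object, with a syzygy of [Z] as cokernel. So an
    [n]-th syzygy has an infinite coresolution by projective objects whose
    cocycles are again [n]-th syzygies; shifting along it moves every Ext group
    into [Y] beyond [id Y], where it vanishes.

    If [pd Inj] is finite, it is at most [id Y] ([pd_Inj_le_id]): the last
    nonzero Ext group of an object of finite projective dimension is already
    nonzero for some projective coefficient object, and these belong to [Y].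
    Hence a finite global Gorenstein dimension equals [id Y], which is the second
    equivalence.

    The relative Gorenstein projective objects are handled through [Gproj], the
    greatest class of objects that have no higher Ext into [Y] and embed into
    projective objects with cokernel in the class. The equality of the
    intersection of [X] and [Y] with the projective objects is what permits
    passing from coresolutions by objects of [X] to projective ones
    ([cycle_Gproj]); conversely, a projective resolution continues such a
    coresolution to the left ([Gproj_GP]).

    Ext groups enter only through their vanishing, which is described by
    extension of maps and syzygies ([extS0]), and the diagram chases use maps
    from projective objects in place of elements. *)

(** * Extended natural numbers *)

Lemma least_le (S : set nat) n :
  (least S <= Fin n)%enat <-> exists j, (j <= n)%N /\ S j.
Proof.
rewrite /least; case: pselect => [exS|nexS] /=.
  case: ex_minnP => m /asboolP Sm minm; split=> [mn|[j [jn Sj]]].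
    by exists m.
  by apply: leq_trans jn; apply/minm/asboolP.
by split=> // -[j [_ Sj]]; case: nexS; exists j; apply/asboolP.
Qed.

Lemma esup_le (S : set enat) n :
  (esup S <= Fin n)%enat <-> forall x, S x -> (x <= Fin n)%enat.
Proof.
split=> [/least_le[j [jn ub]] [m|] /ub //= mj|ub]; first exact: leq_trans mj jn.
by apply/least_le; exists n.
Qed.

(** * Arithmetic of morphisms *)

Section Additive.
Variable C : preadditive.
Implicit Types a b c d : C.

Lemma comp0m a b c (f : hom a b) : (0 : hom b c) ∘ f = 0.
Proof. by apply: (addrI (0 ∘ f)); rewrite -compDl !addr0. Qed.

Lemma compm0 a b c (g : hom b c) : g ∘ (0 : hom a b) = 0.
Proof. by apply: (addrI (g ∘ 0)); rewrite -compDr !addr0. Qed.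

Lemma compNm a b c (g : hom b c) (f : hom a b) : (- g) ∘ f = - (g ∘ f).
Proof. by apply: (addrI (g ∘ f)); rewrite -compDl !subrr comp0m. Qed.

Lemma compmN a b c (g : hom b c) (f : hom a b) : g ∘ (- f) = - (g ∘ f).
Proof. by apply: (addrI (g ∘ f)); rewrite -compDr !subrr compm0. Qed.

Lemma compBl a b c (g g' : hom b c) (f : hom a b) :
  (g - g') ∘ f = g ∘ f - g' ∘ f.
Proof. by rewrite compDl compNm. Qed.

Lemma compBr a b c (g : hom b c) (f f' : hom a b) :
  g ∘ (f - f') = g ∘ f - g ∘ f'.
Proof. by rewrite compDr compmN. Qed.

(** Lets an equation between composites be used inside a longer composite that
    is bracketed to the right. *)
Lemma compK a b c d (g : hom b c) (f : hom a b) (h : hom a c)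
    (u : hom d a) : g ∘ f = h -> g ∘ (f ∘ u) = h ∘ u.
Proof. by move=> <-; rewrite compA. Qed.

Lemma mono_intro a b (f : hom a b) :
  (forall t (u : hom t a), f ∘ u = 0 -> u = 0) -> mono f.
Proof.
move=> f0 t u v fuv; apply/subr0_eq/f0.
by rewrite compBr fuv subrr.
Qed.

Lemma mono_eq0 a b t (f : hom a b) (u : hom t a) : mono f -> f ∘ u = 0 -> u = 0.
Proof. by move=> mf fu; apply: mf; rewrite fu compm0. Qed.

Lemma epi_eq0 a b t (f : hom a b) (u : hom b t) : epi f -> u ∘ f = 0 -> u = 0.
Proof. by move=> ef uf; apply: ef; rewrite uf comp0m. Qed.

Lemma mono_comp a b c (g : hom b c) (f : hom a b) :
  mono g -> mono f -> mono (g ∘ f).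
Proof. by move=> mg mf t u v; rewrite -!compA => /mg /mf. Qed.

Lemma epi_comp a b c (g : hom b c) (f : hom a b) :
  epi g -> epi f -> epi (g ∘ f).
Proof. by move=> eg ef t u v; rewrite !compA => /ef /eg. Qed.

Lemma kernel_mono k a b (i : hom k a) (f : hom a b) : is_kernel i f -> mono i.
Proof.
case=> fi lift t u v iuv.
have [|h [_ uniq]] := lift t (i ∘ u); first by rewrite compA fi comp0m.
by rewrite -(uniq u erefl) -(uniq v (esym iuv)).
Qed.

Lemma cokernel_epi a b q (p : hom b q) (f : hom a b) : is_cokernel p f -> epi p.
Proof.
case=> pf desc t u v upv.
have [|h [_ uniq]] := desc t (u ∘ p); first by rewrite -compA pf compm0.
by rewrite -(uniq u erefl) -(uniq v (esym upv)).
Qed.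

(** Biproducts, presented by equations so that maps into and out of them can be
    computed with. *)
Record biproduct a b s (il : hom a s) (ir : hom b s)
    (pl : hom s a) (pr : hom s b) : Prop := Biproduct {
  pl_il : pl ∘ il = idm a;
  pr_ir : pr ∘ ir = idm b;
  pl_ir : pl ∘ ir = 0;
  pr_il : pr ∘ il = 0;
  il_ir : il ∘ pl + ir ∘ pr = idm s
}.

Lemma biproduct_projective a b s (il : hom a s) (ir : hom b s) pl pr :
  biproduct il ir pl pr -> projective a -> projective b -> projective s.
Proof.
move=> B pa pb x y e f ee.
have [u eu] := pa _ _ e (f ∘ il) ee.
have [v ev] := pb _ _ e (f ∘ ir) ee.
exists (u ∘ pl + v ∘ pr).
by rewrite compDr !compA eu ev -!compA -compDr (il_ir B) compm1.
Qed.

Lemma retract_projective a b (s : hom a b) (r : hom b a) :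
  r ∘ s = idm a -> projective b -> projective a.
Proof.
move=> rs pb x y e f ee; have [u eu] := pb _ _ e (f ∘ r) ee.
by exists (u ∘ s); rewrite compA eu -compA rs compm1.
Qed.

(** Short exact sequences, as pairs that are kernel and cokernel of each other.
    Unlike image factorisations, this form is used directly in arguments. *)
Record ses a b c (f : hom a b) (g : hom b c) : Prop := Ses {
  ses_mono : mono f;
  ses_epi : epi g;
  ses_comp : g ∘ f = 0;
  ses_lift : forall t (v : hom t b), g ∘ v = 0 -> exists u, f ∘ u = v;
  ses_desc : forall t (w : hom b t), w ∘ f = 0 -> exists h, h ∘ g = w
}.

Lemma ses_kernel_of a b c (f : hom a b) (g : hom b c) :
  ses f g -> is_kernel f g.
Proof.
move=> S; split=> [|t v gv]; first exact: ses_comp S.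
have [u fu] := ses_lift S gv.
by exists u; split=> // u' fu'; apply: (ses_mono S); rewrite fu fu'.
Qed.

Lemma kernel_ses a b c (f : hom a b) (g : hom b c) :
  abelian C -> is_kernel f g -> epi g -> ses f g.
Proof.
move=> abC K eg; have [gf lift] := K; split=> //.
- exact: kernel_mono K.
- by move=> t v /lift[u [fu _]]; exists u.
move=> t w wf; have [d [h [gh desc]]] := epi_normal abC eg.
have [u [fu _]] := lift _ _ gh.
have [|x [xg _]] := desc _ w; last by exists x.
by rewrite -fu compA wf comp0m.
Qed.

Lemma ses_short a b c (f : hom a b) (g : hom b c) :
  ses f g -> short_exact f g.
Proof.
move=> S; split; [exact: ses_mono S | | exact: ses_epi S].
exists a, (idm a), f; split; [ | exact: ses_kernel_of | by rewrite compm1].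
by move=> t u v; rewrite !compm1.
Qed.

Lemma short_ses a b c (f : hom a b) (g : hom b c) :
  abelian C -> short_exact f g -> ses f g.
Proof.
move=> abC [mf [k [e [i [ee K fE]]]] eg].
have me : mono e by move=> t u v euv; apply: mf; rewrite fE -!compA euv.
have [d [h [he lift]]] := mono_normal abC me.
(* A mono and epi is the kernel of zero, hence invertible. *)
have h0 : h = 0 by apply: epi_eq0 ee he.
have [|e' [ee' _]] := lift _ (idm k); first by rewrite h0 comp0m.
apply: kernel_ses => //; have [gi liftK] := K; split=> [|t v gv].
  by rewrite fE compA gi comp0m.
have [u [iu _]] := liftK _ _ gv.
exists (e' ∘ u); split=> [|u' fu']; first by rewrite fE -compA (compK _ ee') comp1m.
by apply: mf; rewrite fu' fE -compA (compK _ ee') comp1m.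
Qed.

Lemma ses_kernel a b (g : hom a b) : abelian C -> epi g ->
  exists k (f : hom k a), ses f g.
Proof.
move=> abC eg; have [k [f K]] := has_kernels abC g.
by exists k, f; apply: kernel_ses.
Qed.

Lemma ses_cokernel a b (f : hom a b) : abelian C -> mono f ->
  exists c (g : hom b c), ses f g.
Proof.
move=> abC mf; have [c [g K]] := has_cokernels abC f; exists c, g.
apply: kernel_ses => //; last exact: cokernel_epi K.
have [d [h [hf lift]]] := mono_normal abC mf; have [gf desc] := K.
have [x [xg _]] := desc _ _ hf.
by split=> // t v gv; apply: lift; rewrite -xg -compA gv compm0.
Qed.

End Additive.

(** * Diagram chasing with maps from projective objects *)

(** With enough projectives, maps [p -> a] from projective objects behave as
    elements of [a]: they detect zero, monomorphisms and epimorphisms, and they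
    lift along epimorphisms. The lemmas of this part turn this into the few
    constructions from which everything else is assembled. *)

Section Chase.
Variable C : preadditive.
Hypotheses (abC : abelian C) (epC : enough_projectives C).
Implicit Types a b c d p : C.

Lemma elem_eq0 a b (f : hom a b) :
  (forall p (u : hom p a), projective p -> f ∘ u = 0) -> f = 0.
Proof.
move=> f0; have [p [e [pp ee]]] := epC a.
by apply: epi_eq0 ee _; apply: f0.
Qed.

Lemma elem_mono a b (f : hom a b) :
  (forall p (u : hom p a), projective p -> f ∘ u = 0 -> u = 0) -> mono f.
Proof.
move=> f0; apply: mono_intro => t u fu; apply: elem_eq0 => p v pp.
by apply: f0 => //; rewrite compA fu comp0m.
Qed.

Lemma elem_epi a b (f : hom a b) :
  (forall p (v : hom p b), projective p -> exists u, f ∘ u = v) -> epi f.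
Proof.
move=> fs t u v ufvf; have [p [e [pp ee]]] := epC b.
have [w fw] := fs p e pp.
by apply: ee; rewrite -fw !compA ufvf.
Qed.

Lemma elem_ses a b c (f : hom a b) (g : hom b c) :
  (forall p (u : hom p a), projective p -> f ∘ u = 0 -> u = 0) ->
  g ∘ f = 0 ->
  (forall p (v : hom p b), projective p -> g ∘ v = 0 -> exists u, f ∘ u = v) ->
  (forall p (w : hom p c), projective p -> exists v, g ∘ v = w) ->
  ses f g.
Proof.
move=> f0 gf lift gs; have mf := elem_mono f0; have eg := elem_epi gs.
apply: kernel_ses => //; split=> // t v gv.
have [d [h [hf liftf]]] := mono_normal abC mf.
apply: liftf; apply: elem_eq0 => p w pp.
have [|u fu] := lift p (v ∘ w) pp; first by rewrite compA gv comp0m.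
by rewrite -compA -fu compA hf comp0m.
Qed.

Lemma has_biproduct a b :
  exists s (il : hom a s) (ir : hom b s) pl pr, biproduct il ir pl pr.
Proof.
pose F (i : bool) := if i then a else b.
have [s [inj univ]] := has_coproducts abC F.
pose out t (u : hom a t) (v : hom b t) (i : bool) : hom (F i) t :=
  if i return hom (if i then a else b) t then u else v.
have [pl [plE _]] := univ _ (out _ (idm a) 0).
have [pr [prE _]] := univ _ (out _ 0 (idm b)).
have [x [_ uniq]] := univ _ inj.
exists s, (inj true), (inj false), pl, pr; split.
- exact: plE true.
- exact: prE false.
- exact: plE false.
- exact: prE true.
rewrite -(uniq (idm s)) => [|i]; last by rewrite comp1m.
apply/esym/uniq => -[]; rewrite compDl -!compA.
  by rewrite (plE true) (prE true) compm1 compm0 addr0.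
by rewrite (plE false) (prE false) compm1 compm0 add0r.
Qed.

(** Pushouts serve to enlarge the kernel of a short exact sequence while
    embedding its middle term into the new one, so both the row [f', g'] and the
    column [h', k'] of the square are recorded. *)
Lemma pushout_ses a b c d d' (f : hom a b) (g : hom b c)
    (h : hom a d) (k : hom d d') : ses f g -> ses h k ->
  exists t (f' : hom d t) (g' : hom t c) (h' : hom b t) (k' : hom t d'),
    [/\ ses f' g', ses h' k', g' ∘ h' = g, k' ∘ f' = k & h' ∘ f = f' ∘ h].
Proof.
move=> S T; have [s [il [ir [pl [pr B]]]]] := has_biproduct b d.
pose m := il ∘ f - ir ∘ h.
have plm : pl ∘ m = f.
  by rewrite compBr !compA (pl_il B) (pl_ir B) comp0m subr0 comp1m.
have prm : pr ∘ m = - h.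
  by rewrite compBr !compA (pr_il B) (pr_ir B) comp0m sub0r comp1m.
have mm : mono m.
  apply: mono_intro => t u mu; apply: (mono_eq0 (ses_mono S)).
  by rewrite -plm -compA mu compm0.
have [t [q U]] := ses_cokernel abC mm.
have [g' g'E] : exists g', g' ∘ q = g ∘ pl.
  by apply: (ses_desc U); rewrite -compA plm (ses_comp S).
have [k' k'E] : exists k', k' ∘ q = k ∘ pr.
  by apply: (ses_desc U); rewrite -compA prm compmN (ses_comp T) oppr0.
have qm : q ∘ il ∘ f = q ∘ ir ∘ h.
  by apply/subr0_eq; have := ses_comp U; rewrite /m compBr !compA.
have g'l : g' ∘ (q ∘ il) = g by rewrite compA g'E -compA (pl_il B) compm1.
have g'r : g' ∘ (q ∘ ir) = 0 by rewrite compA g'E -compA (pl_ir B) compm0.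
have k'l : k' ∘ (q ∘ il) = 0 by rewrite compA k'E -compA (pr_il B) compm0.
have k'r : k' ∘ (q ∘ ir) = k by rewrite compA k'E -compA (pr_ir B) compm1.
(* An element of the pushout is the sum of one coming from each side. *)
have split_elem p (v : hom p t) : projective p ->
    exists x y, v = q ∘ il ∘ x + q ∘ ir ∘ y.
  move=> pp; have [w <-] := pp _ _ q v (ses_epi U).
  exists (pl ∘ w), (pr ∘ w).
  by rewrite -!compA -compDr !compA -compDl (il_ir B) comp1m.
have q_eq0 p (x : hom p b) (y : hom p d) : q ∘ il ∘ x + q ∘ ir ∘ y = 0 ->
    exists z, f ∘ z = x /\ - h ∘ z = y.
  move=> E; have [|z zE] := ses_lift U (v := il ∘ x + ir ∘ y).
    by rewrite compDr !compA.
  exists z; rewrite -plm -prm -!compA zE !compDr !compA.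
  by rewrite (pl_il B) (pl_ir B) (pr_il B) (pr_ir B) !comp0m !comp1m addr0 add0r.
exists t, (q ∘ ir), g', (q ∘ il), k'; split=> //.
- apply: elem_ses => // [p u pp E|p v pp|p w pp].
  + have [|z [fz <-]] := q_eq0 p 0 u; first by rewrite compm0 add0r.
    by rewrite (mono_eq0 (ses_mono S) fz) compm0.
  + have [x [y ->]] := split_elem p v pp.
    rewrite compDr -!compA (compA g') !compA -(compA g') g'l -(compA g') g'r.
    rewrite comp0m addr0 => gx; have [z <-] := ses_lift S gx.
    by exists (h ∘ z + y); rewrite compDr !compA qm.
  have [v <-] := pp _ _ g w (ses_epi S).
  by exists (q ∘ il ∘ v); rewrite compA g'l.
apply: elem_ses => // [p u pp E|p v pp|p w pp].
- have [|z [<- hz]] := q_eq0 p u 0; first by rewrite compm0 addr0.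
  rewrite (mono_eq0 (ses_mono T) (u := z)) ?compm0 //.
  by apply/eqP; rewrite -oppr_eq0 -compNm hz.
- have [x [y ->]] := split_elem p v pp.
  rewrite compDr !compA -(compA k') k'l -(compA k') k'r.
  rewrite comp0m add0r => ky; have [z <-] := ses_lift T ky.
  by exists (x + f ∘ z); rewrite compDr !compA qm.
have [v <-] := pp _ _ k w (ses_epi T).
by exists (q ∘ ir ∘ v); rewrite compA k'r.
Qed.

(** The third isomorphism theorem. After a pushout it embeds the middle of an
    extension into a prescribed object with control over the cokernel. *)
Lemma composite_ses a b c d x (f : hom a b) (g : hom b c)
    (i : hom b d) (p : hom d x) : ses f g -> ses i p ->
  exists q (r : hom d q) (j : hom c q) (l : hom q x),
    [/\ ses (i ∘ f) r, ses j l, r ∘ i = j ∘ g & l ∘ r = p].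
Proof.
move=> S T.
have [q [r U]] := ses_cokernel abC (mono_comp (ses_mono T) (ses_mono S)).
have [j jE] : exists j, j ∘ g = r ∘ i.
  by apply: (ses_desc S); rewrite -compA (ses_comp U).
have [l lE] : exists l, l ∘ r = p.
  by apply: (ses_desc U); rewrite compA (ses_comp T) comp0m.
exists q, r, j, l; split=> //; apply: elem_ses => [y u py||y v py|y w py].
- have [v <-] := py _ _ g u (ses_epi S) => E.
  have [|z zE] := ses_lift U (v := i ∘ v); first by rewrite compA -jE -compA.
  have <- : f ∘ z = v by apply: (ses_mono T); rewrite compA.
  by rewrite compA (ses_comp S) comp0m.
- by apply: (ses_epi S); rewrite -compA jE compA lE (ses_comp T) comp0m.
- have [w <-] := py _ _ r v (ses_epi U); rewrite compA lE => pw.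
  have [z <-] := ses_lift T pw.
  by exists (g ∘ z); rewrite !compA jE.
have [v <-] := py _ _ p w (ses_epi T).
by exists (r ∘ v); rewrite compA lE.
Qed.

(** Pullbacks compare two presentations of the same object [c]: the kernels
    of both occur in short exact sequences with the same middle term [l]. *)
Lemma pullback_ses a b c k q (f : hom a b) (g : hom b c)
    (i : hom k q) (e : hom q c) : ses f g -> ses i e ->
  exists l (i' : hom k l) (e' : hom l b) (f' : hom a l) (g' : hom l q),
    [/\ ses i' e', ses f' g', g ∘ e' = e ∘ g', g' ∘ i' = i & e' ∘ f' = f].
Proof.
move=> S T; have [s [il [ir [pl [pr B]]]]] := has_biproduct b q.
pose m := g ∘ pl - e ∘ pr.
have ml : m ∘ il = g.
  by rewrite compBl -!compA (pl_il B) (pr_il B) compm0 subr0 compm1.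
have mr : m ∘ ir = - e.
  by rewrite compBl -!compA (pl_ir B) (pr_ir B) compm0 sub0r compm1.
have em : epi m.
  apply: elem_epi => p v pp; have [w <-] := pp _ _ g v (ses_epi S).
  by exists (il ∘ w); rewrite compA ml.
have [l [j U]] := ses_kernel abC em.
have pair_elem p (x : hom p b) (y : hom p q) : g ∘ x = e ∘ y ->
    exists z, pl ∘ (j ∘ z) = x /\ pr ∘ (j ∘ z) = y.
  move=> E; have [|z zE] := ses_lift U (v := il ∘ x + ir ∘ y).
    by rewrite compDr !compA ml mr compNm E subrr.
  exists z; rewrite zE !compDr !compA.
  by rewrite (pl_il B) (pl_ir B) (pr_il B) (pr_ir B) !comp0m !comp1m addr0 add0r.
have elem0 p (z : hom p l) : pl ∘ (j ∘ z) = 0 -> pr ∘ (j ∘ z) = 0 -> z = 0.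
  move=> E F; apply: (mono_eq0 (ses_mono U)).
  by rewrite -[LHS]comp1m -(il_ir B) compDl -!compA E F !compm0 addr0.
have sq : g ∘ (pl ∘ j) = e ∘ (pr ∘ j).
  by apply/subr0_eq; have := ses_comp U; rewrite /m compBl -!compA.
have [|i' [pli pri]] := pair_elem k 0 i; first by rewrite compm0 (ses_comp T).
have [|f' [plf prf]] := pair_elem a f 0; first by rewrite compm0 (ses_comp S).
exists l, i', (pl ∘ j), f', (pr ∘ j); split=> //; rewrite -?compA //.
- apply: elem_ses => [p u pp E||p v pp E|p w pp]; rewrite -?compA //.
  + by apply: (mono_eq0 (ses_mono T)); rewrite -pri -!compA E !compm0.
  + have [|u uE] := ses_lift T (v := pr ∘ (j ∘ v)).
      by rewrite (compA pr) compA -sq -!compA (compA pl) E compm0.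
    exists u; apply/subr0_eq/elem0; rewrite !compBr.
      by rewrite (compA j) compA pli comp0m (compA pl) E subrr.
    by rewrite (compA j) compA pri uE subrr.
  have [y yE] := pp _ _ e (g ∘ w) (ses_epi T).
  have [z [<- _]] := pair_elem p w y (esym yE).
  by exists z; rewrite compA.
apply: elem_ses => [p u pp E||p v pp E|p w pp]; rewrite -?compA //.
- by apply: (mono_eq0 (ses_mono S)); rewrite -plf -!compA E !compm0.
- have [|u uE] := ses_lift S (v := pl ∘ (j ∘ v)).
    by rewrite (compA pl) compA sq -!compA (compA pr) E compm0.
  exists u; apply/subr0_eq/elem0; rewrite !compBr.
    by rewrite (compA j) compA plf uE subrr.
  by rewrite (compA j) compA prf comp0m (compA pr) E subrr.
have [y yE] := pp _ _ g (e ∘ w) (ses_epi S).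
have [z [_ <-]] := pair_elem p y w yE.
by exists z; rewrite compA.
Qed.

(** The horseshoe lemma for one step of a projective resolution. *)
Lemma horseshoe a b c ka kc p q (f : hom a b) (g : hom b c)
    (ia : hom ka p) (ea : hom p a) (ic : hom kc q) (ec : hom q c) :
  ses f g -> ses ia ea -> ses ic ec -> projective q ->
  exists s (il : hom p s) (ir : hom q s) pl pr kb
    (ib : hom kb s) (eb : hom s b) (fk : hom ka kb) (gk : hom kb kc),
    [/\ biproduct il ir pl pr, ses ib eb, ses fk gk,
        ib ∘ fk = il ∘ ia & pr ∘ ib = ic ∘ gk].
Proof.
move=> S Ta Tc pq; have [s [il [ir [pl [pr B]]]]] := has_biproduct p q.
have [t tE] := pq _ _ g ec (ses_epi S).
pose eb := f ∘ ea ∘ pl + t ∘ pr.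
have ebl : eb ∘ il = f ∘ ea.
  by rewrite compDl -!compA (pl_il B) (pr_il B) !compm0 addr0 compm1.
have ebr : eb ∘ ir = t.
  by rewrite compDl -!compA (pl_ir B) (pr_ir B) !compm0 add0r compm1.
have geb : g ∘ eb = ec ∘ pr.
  by rewrite compDr !compA (ses_comp S) !comp0m add0r tE.
have eeb : epi eb.
  apply: elem_epi => x v px.
  have [y yE] := px _ _ ec (g ∘ v) (ses_epi Tc).
  have [|z zE] := ses_lift S (v := v - t ∘ y).
    by rewrite compBr compA tE yE subrr.
  have [w wE] := px _ _ ea z (ses_epi Ta).
  exists (il ∘ w + ir ∘ y).
  by rewrite compDr !compA ebl ebr -compA wE zE subrK.
have [kb [ib Tb]] := ses_kernel abC eeb.
have [fk fkE] : exists fk, ib ∘ fk = il ∘ ia.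
  by apply: (ses_lift Tb); rewrite compA ebl -compA (ses_comp Ta) compm0.
have [gk gkE] : exists gk, ic ∘ gk = pr ∘ ib.
  by apply: (ses_lift Tc); rewrite compA -geb -compA (ses_comp Tb) compm0.
exists s, il, ir, pl, pr, kb, ib, eb, fk, gk; split=> //.
apply: elem_ses => [x u px E||x v px E|x w px].
- apply: (mono_eq0 (ses_mono Ta)); rewrite -[LHS]comp1m -(pl_il B) -compA.
  by rewrite (compA il) -fkE -compA E !compm0.
- apply: (ses_mono Tc).
  by rewrite compA gkE -compA fkE compA (pr_il B) comp0m compm0.
- have prv : pr ∘ (ib ∘ v) = 0 by rewrite compA -gkE -compA E compm0.
  have vE : ib ∘ v = il ∘ (pl ∘ (ib ∘ v)).
    by rewrite -[LHS]comp1m -(il_ir B) compDl -!compA prv compm0 addr0.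
  have [|u uE] := ses_lift Ta (v := pl ∘ (ib ∘ v)).
    apply: (mono_eq0 (ses_mono S)).
    by rewrite compA -ebl -compA -vE compA (ses_comp Tb) comp0m.
  by exists u; apply: (ses_mono Tb); rewrite vE -uE !compA fkE.
have [|y yE] := ses_lift S (v := t ∘ (ic ∘ w)).
  by rewrite compA tE compA (ses_comp Tc) comp0m.
have [z zE] := px _ _ ea y (ses_epi Ta).
have [|v vE] := ses_lift Tb (v := ir ∘ (ic ∘ w) - il ∘ z).
  by rewrite compBr !compA ebl ebr -!compA zE yE subrr.
exists v; apply: (ses_mono Tc); rewrite compA gkE -compA vE compBr !compA.
by rewrite (pr_ir B) (pr_il B) comp0m subr0 comp1m.
Qed.

End Chase.

(** * Vanishing of Ext by dimension shifting *)

Section Ext.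
Variable C : preadditive.
Hypotheses (abC : abelian C) (epC : enough_projectives C).
Implicit Types a b c d k p q M N : C.

(** The vanishing of the Ext group of degree [n.+1], not [n]: degree one is the
    extension property along every short exact sequence, and higher degrees are
    shifted down along all syzygies. Quantifying over all sequences makes this
    easy to use; that a single syzygy suffices is [extS0_syzygy] below. *)
Fixpoint extS0 n (M N : C) : Prop :=
  match n with
  | 0%N => forall a b (f : hom a b) (g : hom b M), ses f g ->
      forall u : hom a N, exists v, v ∘ f = u
  | n.+1 => forall k p (i : hom k p) (e : hom p M), projective p -> ses i e ->
      extS0 n k N
  end.

Lemma projective_cover M : exists k p (i : hom k p) (e : hom p M),
  projective p /\ ses i e.
Proof.
have [p [e [pp ee]]] := epC M; have [k [i S]] := ses_kernel abC ee.
by exists k, p, i, e.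
Qed.

Lemma ses_section a b c (f : hom a b) (g : hom b c) s :
  ses f g -> g ∘ s = idm c -> exists r, r ∘ f = idm a /\ f ∘ r + s ∘ g = idm b.
Proof.
move=> S gs; have [|r rE] := ses_lift S (v := idm b - s ∘ g).
  by rewrite compBr compA gs compm1 comp1m subrr.
exists r; rewrite rE subrK; split=> //; apply: (ses_mono S).
by rewrite compA rE compBl comp1m -compA (ses_comp S) compm0 subr0 compm1.
Qed.

Lemma ses_retraction a b c (f : hom a b) (g : hom b c) r :
  ses f g -> r ∘ f = idm a -> exists s, g ∘ s = idm c.
Proof.
move=> S rf; have [|s sE] := ses_desc S (w := idm b - f ∘ r).
  by rewrite compBl -compA rf comp1m compm1 subrr.
exists s; apply: (ses_epi S).
by rewrite -compA sE compBr compA (ses_comp S) comp0m subr0 compm1 comp1m.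
Qed.

Lemma ses_projective_split a b q (f : hom a b) (g : hom b q) :
  projective q -> ses f g -> exists r, r ∘ f = idm a.
Proof.
move=> pq S; have [s gs] := pq _ _ g (idm q) (ses_epi S).
by have [r [rf _]] := ses_section S gs; exists r.
Qed.

Lemma extS0_projective n q N : projective q -> extS0 n q N.
Proof.
elim: n q => [|n IH] q pq /=.
  move=> a b f g S u; have [r rf] := ses_projective_split pq S.
  by exists (u ∘ r); rewrite -compA rf compm1.
move=> k p i e pp S; apply: IH.
by have [r ri] := ses_projective_split pq S; apply: retract_projective ri pp.
Qed.

(** Degree one vanishing can be tested on one projective presentation: pulled
    back along it, any other short exact sequence splits. *)
Lemma ext1_intro k p M N (i : hom k p) (e : hom p M) :
  projective p -> ses i e -> (forall u : hom k N, exists v, v ∘ i = u) ->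
  extS0 0 M N.
Proof.
move=> pp S ext a b f g T u.
have [l [i' [e' [f' [g' [S' T' _ g'i e'f]]]]]] := pullback_ses abC epC T S.
have [r rf] := ses_projective_split pp T'.
have [v vE] := ext (u ∘ r ∘ i').
have [|h hE] := ses_desc S' (w := u ∘ r - v ∘ g').
  by rewrite compBl -(compA v) g'i vE subrr.
exists h; rewrite -e'f compA hE compBl -!compA rf (ses_comp T').
by rewrite compm0 subr0 compm1.
Qed.

(** Exactness of the long sequence at the Ext group of degree one of [c], where
    the connecting map starts from homomorphisms rather than from an Ext
    group. *)
Lemma ext1_quotient a b c N (f : hom a b) (g : hom b c) : ses f g ->
  (forall u : hom a N, exists v, v ∘ f = u) -> extS0 0 b N -> extS0 0 c N.
Proof.
move=> S ext Eb; have [k [p [i [e [pp T]]]]] := projective_cover c.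
apply: (ext1_intro pp T) => u.
have [l [i' [e' [f' [g' [S' T' _ g'i e'f]]]]]] := pullback_ses abC epC S T.
have [v vE] := Eb _ _ _ _ S' u; have [w wE] := ext (v ∘ f').
have [|h hE] := ses_desc T' (w := v - w ∘ e').
  by rewrite compBl -compA e'f wE subrr.
exists h; rewrite -g'i compA hE compBl -compA (ses_comp S').
by rewrite compm0 subr0.
Qed.

Lemma ext1_extension a b c N (f : hom a b) (g : hom b c) :
  ses f g -> extS0 0 a N -> extS0 0 c N -> extS0 0 b N.
Proof.
move=> S Ea Ec.
have [ka [p [ia [ea [pp Ta]]]]] := projective_cover a.
have [kc [q [ic [ec [pq Tc]]]]] := projective_cover c.
have [s [il [ir [pl [pr [kb [ib [eb [fk [gk [B Tb K fkE gkE]]]]]]]]]]] :=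
  horseshoe abC epC S Ta Tc pq.
apply: (ext1_intro (biproduct_projective B pp pq) Tb) => u.
have [v vE] := Ea _ _ _ _ Ta (u ∘ fk).
have [|w wE] := ses_desc K (w := u - v ∘ pl ∘ ib).
  rewrite compBl -(compA _ ib) fkE -!compA (compA pl) (pl_il B) comp1m vE.
  by rewrite subrr.
have [x xE] := Ec _ _ _ _ Tc w.
by exists (v ∘ pl + x ∘ pr); rewrite compDl -(compA x) gkE compA xE wE addrC subrK.
Qed.

(** Exactness of the long sequence at [a]. The horseshoe lemma produces a short
    exact sequence of syzygies, which lowers the degree. *)
Lemma extS0_kernel n a b c N (f : hom a b) (g : hom b c) :
  ses f g -> extS0 n b N -> extS0 n.+1 c N -> extS0 n a N.
Proof.
elim: n a b c f g => [|n IH] a b c f g S Eb Ec.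
  have [ka [p [ia [ea [pp Ta]]]]] := projective_cover a.
  have [kc [q [ic [ec [pq Tc]]]]] := projective_cover c.
  have [s [il [ir [pl [pr [kb [ib [eb [fk [gk [B Tb K fkE gkE]]]]]]]]]]] :=
    horseshoe abC epC S Ta Tc pq.
  apply: (ext1_intro pp Ta) => u.
  have [v vE] := Ec _ _ _ _ pq Tc _ _ _ _ K u.
  have [w wE] := Eb _ _ _ _ Tb v.
  by exists (w ∘ il); rewrite -compA -fkE compA wE vE.
move=> ka p ia ea pp Ta.
have [kc [q [ic [ec [pq Tc]]]]] := projective_cover c.
have [s [il [ir [pl [pr [kb [ib [eb [fk [gk [B Tb K fkE gkE]]]]]]]]]]] :=
  horseshoe abC epC S Ta Tc pq.
apply: IH K _ _; last exact: Ec Tc.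
exact: Eb (biproduct_projective B pp pq) Tb.
Qed.

(** The syzygy [kb] of [b] is given, so the horseshoe lemma does not apply to
    it. Instead the kernel [l] of [p -> b -> c] is a syzygy of [c] that maps onto
    [a] with kernel [kb]. *)
Lemma extS0_extension n a b c N (f : hom a b) (g : hom b c) :
  ses f g -> extS0 n a N -> extS0 n c N -> extS0 n b N.
Proof.
case: n => [|n] S; first exact: ext1_extension S.
move=> Ea Ec kb p i e pp Tb.
have [l [j T]] := ses_kernel abC (epi_comp (ses_epi S) (ses_epi Tb)).
have El : extS0 n l N by apply: Ec T.
have [h hE] : exists h, f ∘ h = e ∘ j.
  by apply: (ses_lift S); rewrite compA (ses_comp T).
have [m mE] : exists m, j ∘ m = i.
  by apply: (ses_lift T); rewrite -compA (ses_comp Tb) compm0.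
suff U : ses m h by apply: extS0_kernel U El Ea.
apply: (elem_ses abC epC) => [x u px E||x v px E|x w px].
- by apply: (mono_eq0 (ses_mono Tb)); rewrite -mE -compA E compm0.
- by apply: (ses_mono S); rewrite compA hE -compA mE (ses_comp Tb) compm0.
- have [|u uE] := ses_lift Tb (v := j ∘ v).
    by rewrite compA -hE -compA E compm0.
  by exists u; apply: (ses_mono T); rewrite compA mE.
have [y yE] := px _ _ e (f ∘ w) (ses_epi Tb).
have [|v vE] := ses_lift T (v := y).
  by rewrite -compA yE compA (ses_comp S) comp0m.
by exists v; apply: (ses_mono S); rewrite compA hE -compA vE.
Qed.

(** The pullback [l] of [b] and of the cover of [c] is an extension of a
    projective object by [a], and its quotient by the syzygy of [c] is [b]. *)
Lemma extS0_quotient n a b c N (f : hom a b) (g : hom b c) :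
  ses f g -> extS0 n a N -> extS0 n.+1 b N -> extS0 n.+1 c N.
Proof.
move=> S Ea Eb k p i e pp T.
have [l [i' [e' [f' [g' [S' T' _ _ _]]]]]] := pullback_ses abC epC S T.
by apply: (extS0_kernel S') Eb; apply: extS0_extension T' Ea _; apply: extS0_projective.
Qed.

Lemma extS0_syzygy n k p M N (i : hom k p) (e : hom p M) :
  projective p -> ses i e -> extS0 n k N -> extS0 n.+1 M N.
Proof.
by move=> pp S Ek; apply: extS0_quotient S Ek _; apply: extS0_projective.
Qed.

(** For a retract [a] of [b], a projective cover of [a] and one of its
    complement add up to a cover of [b], and its kernel retracts onto the kernel
    of the given cover of [a]. *)
Lemma retract_cover a b k p (s : hom a b) (r : hom b a)
    (i : hom k p) (e : hom p a) :
  r ∘ s = idm a -> projective p -> ses i e ->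
  exists k' p' (i' : hom k' p') (e' : hom p' b) (ks : hom k k') (kr : hom k' k)
    (ps : hom p p'),
    [/\ projective p', ses i' e', kr ∘ ks = idm k & i' ∘ ks = ps ∘ i].
Proof.
move=> rs pp S.
have er : epi r.
  by apply: (elem_epi epC) => x v px; exists (s ∘ v); rewrite compA rs comp1m.
have [c [j T]] := ses_kernel abC er; have [q [t [pq et]]] := epC c.
have [p' [il [ir [pl [pr B]]]]] := has_biproduct abC p q.
pose e' := s ∘ e ∘ pl + j ∘ t ∘ pr.
have e'l : e' ∘ il = s ∘ e.
  by rewrite compDl -!compA (pl_il B) (pr_il B) !compm0 addr0 compm1.
have e'r : e' ∘ ir = j ∘ t.
  by rewrite compDl -!compA (pl_ir B) (pr_ir B) !compm0 add0r compm1.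
have re' : r ∘ e' = e ∘ pl.
  by rewrite compDr !compA rs (ses_comp T) !comp0m addr0 comp1m.
have ee' : epi e'.
  apply: (elem_epi epC) => x w px.
  have [y yE] := px _ _ e (r ∘ w) (ses_epi S).
  have [|z zE] := ses_lift T (v := w - s ∘ (r ∘ w)).
    by rewrite compBr (compA r s) rs comp1m subrr.
  have [v vE] := px _ _ t z et.
  exists (il ∘ y + ir ∘ v).
  by rewrite compDr !compA e'l e'r -!compA yE vE zE addrC subrK.
have [k' [i' S']] := ses_kernel abC ee'.
have [ks ksE] : exists ks, i' ∘ ks = il ∘ i.
  by apply: (ses_lift S'); rewrite compA e'l -compA (ses_comp S) compm0.
have [kr krE] : exists kr, i ∘ kr = pl ∘ i'.
  by apply: (ses_lift S); rewrite compA -re' -compA (ses_comp S') compm0.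
exists k', p', i', e', ks, kr, il; split=> //.
  exact: biproduct_projective B pp pq.
apply: (ses_mono S).
by rewrite compA krE -compA ksE compA (pl_il B) comp1m compm1.
Qed.

Lemma extS0_retract n a b N (s : hom a b) (r : hom b a) :
  r ∘ s = idm a -> extS0 n b N -> extS0 n a N.
Proof.
elim: n a b s r => [|n IH] a b s r rs Eb; last first.
  move=> k p i e pp S.
  have [k' [p' [i' [e' [ks [kr [ps [pp' S' krs _]]]]]]]] := retract_cover rs pp S.
  by apply: IH krs _; apply: Eb S'.
have [k [p [i [e [pp S]]]]] := projective_cover a.
have [k' [p' [i' [e' [ks [kr [ps [pp' S' krs i'E]]]]]]]] := retract_cover rs pp S.
apply: (ext1_intro pp S) => u; have [v vE] := Eb _ _ _ _ S' (u ∘ kr).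
by exists (v ∘ ps); rewrite -compA -i'E compA vE -compA krs compm1.
Qed.

(** ** Comparison with cohomology of projective resolutions *)

Lemma exact_factor a b c d k (e : hom a k) (i : hom k b) (g : hom b c)
    (j : hom c d) : epi e -> ses i g -> mono j -> exact (i ∘ e) (j ∘ g).
Proof.
move=> ee S mj; exists k, e, i; split=> //; split=> [|t v].
  by rewrite -compA (ses_comp S) compm0.
by rewrite -compA => /(mono_eq0 mj); apply: (ses_kernel_of S).2.
Qed.

Lemma exact_mono_comp a b c d (f : hom a b) (g : hom b c) (j : hom c d) :
  mono j -> exact f (j ∘ g) <-> exact f g.
Proof.
move=> mj; split=> -[k [e [i [ee [gi lift] fE]]]]; exists k, e, i; split=> //.
  split=> [|t v gv]; first by apply: (mono_eq0 mj); rewrite compA.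
  by apply: lift; rewrite -compA gv compm0.
split=> [|t v]; first by rewrite -compA gi compm0.
by rewrite -compA => /(mono_eq0 mj); apply: lift.
Qed.

Lemma exact_kernel a b c k (f : hom a b) (g : hom b c) (i : hom k b) :
  exact f g -> is_kernel i g -> exists e : hom a k, epi e /\ f = i ∘ e.
Proof.
move=> [k0 [e [i0 [ee K0 ->]]]] K.
have [h [hE _]] := K.2 _ _ K0.1; have [h' [h'E _]] := K0.2 _ _ K.1.
exists (h ∘ e); split; last by rewrite compA hE.
apply: epi_comp ee => t u v E.
have hh' : h ∘ h' = idm k.
  by apply: (kernel_mono K); rewrite compA hE h'E compm1.
by rewrite -(compm1 u) -hh' compA E -compA hh' compm1.
Qed.

Definition ses_resolution (Z L : nat -> C) (i : forall m, hom (Z m.+1) (L m))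
    (e : forall m, hom (L m) (Z m)) (S : forall m, ses (i m) (e m)) :
  resolution (Z 0%N).
Proof.
apply: (@Resolution _ _ L (fun m => i m ∘ e m.+1) (e 0%N)) => [||m].
- exact: ses_epi (S 0%N).
- rewrite -[e 0%N]comp1m; apply: exact_factor (S 0%N) _; first exact: ses_epi.
  by move=> t u v; rewrite !comp1m.
by apply: exact_factor; [exact: ses_epi | exact: S | exact: ses_mono].
Defined.

Definition cons_obj M k p (R : resolution k) (m : nat) : C :=
  if m is m'.+1 then R m' else p.

Definition cons_resolution k p M (i : hom k p) (e : hom p M) (S : ses i e)
    (R : resolution k) : resolution M.
Proof.
apply: (@Resolution _ _ (cons_obj M p R)
  (fun m => if m is m'.+1 return hom (cons_obj M p R m.+1) (cons_obj M p R m)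
            then res_d R m' else i ∘ res_aug R) e) => [||[|m] /=].
- exact: ses_epi S.
- exists k, (res_aug R), i; split=> //; first exact: res_aug_epi.
  exact: ses_kernel_of.
- by apply/exact_mono_comp; [exact: ses_mono S | exact: res_exact0].
- exact: res_exactS.
Defined.

Definition tail_resolution M (R : resolution M) k (i : hom k (R 0%N))
    (S : ses i (res_aug R)) (e : hom (R 1%N) k) (ee : epi e)
    (dE : res_d R 0%N = i ∘ e) : resolution k.
Proof.
apply: (@Resolution _ _ (fun m => R m.+1) (fun m => res_d R m.+1) e ee) => [|m].
  by apply: (exact_mono_comp _ _ (ses_mono S)).1; rewrite -dE; apply: res_exactS.
exact: res_exactS.
Defined.

Lemma tail_exists M (R : resolution M) :
  exists k (i : hom k (R 0%N)) (e : hom (R 1%N) k),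
  [/\ ses i (res_aug R), epi e & res_d R 0%N = i ∘ e].
Proof.
have [k [i S]] := ses_kernel abC (@res_aug_epi _ _ R).
have [e [ee dE]] := exact_kernel (res_exact0 R) (ses_kernel_of S).
by exists k, i, e.
Qed.

Record cover M := Cover {
  cover_ker : C;
  cover_obj : C;
  cover_in : hom cover_ker cover_obj;
  cover_map : hom cover_obj M;
  cover_proj : projective cover_obj;
  cover_ses : ses cover_in cover_map
}.

Lemma choose_cover M : cover M.
Proof.
have [k /cid[p /cid[i /cid[e [pp S]]]]] := cid (projective_cover M).
exact: Cover pp S.
Qed.

Fixpoint syzygies M m : C :=
  if m is m'.+1 then cover_ker (choose_cover (syzygies M m')) else M.

Definition projective_resolution M : resolution M :=
  ses_resolution (Z := syzygies M)
    (fun m => cover_ses (choose_cover (syzygies M m))).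

Lemma projective_resolutionP M m : Proj C (projective_resolution M m).
Proof. exact: cover_proj. Qed.

(** Both sides shift degrees along a syzygy: resolutions of [M] arise from those
    of a syzygy by adding a projective object in front, and conversely the tail
    of a resolution of [M] resolves a syzygy. In degree one, a cocycle on the
    first tail object is a map on the syzygy, and it is a coboundary when this
    map extends. *)
Lemma Ext_eq0_extS0 n M N : Ext_eq0 n.+1 M N <-> extS0 n M N.
Proof.
split.
  elim: n M => [|n IH] M E.
    have [k [p [i [e [pp S]]]]] := projective_cover M.
    apply: (ext1_intro pp S) => u.
    have [R PR'] : exists R : resolution k, forall m, Proj C (R m).
      by exists (projective_resolution k) => m; apply: projective_resolutionP.
    have PR m : Proj C (cons_resolution S R m) by case: m.
    have [|v vE] := E _ PR (u ∘ res_aug R).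
      have [l [x [y [_ [dy _] dE]]]] := res_exact0 R.
      by rewrite /cocycle /= dE -compA (compA _ y) dy comp0m compm0.
    exists v; apply: (@res_aug_epi _ _ R).
    by rewrite vE /= compA.
  move=> k p i e pp S; apply: IH => R PR f cf.
  have PR' m : Proj C (cons_resolution S R m) by case: m.
  exact: (E _ PR' f cf).
elim: n M => [|n IH] M E R PR f cf;
  have [k [i [e [S ee dE]]]] := tail_exists R; last first.
  have Ek := E _ _ _ _ (PR 0%N) S.
  by have := IH _ Ek (tail_resolution S ee dE) (fun m => PR m.+1) f cf.
pose T := tail_resolution S ee dE.
have [u uE] : exists u, u ∘ e = f.
  have [l [x [y [ex [ey lift] d1E]]]] := res_exact0 T.
  have Se : ses y e by apply: kernel_ses.
  apply: (ses_desc Se); apply: epi_eq0 ex _.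
  by rewrite -compA -d1E.
have [v vE] := E _ _ _ _ S u.
by exists v; rewrite dE compA vE.
Qed.

End Ext.

(** * Relative Gorenstein projective objects *)

Section Gorenstein.
Variable C : preadditive.
Hypotheses (abC : abelian C) (epC : enough_projectives C).
Implicit Types a b c d k p q x y z M N : C.

Lemma exact_comp0 a b c (f : hom a b) (g : hom b c) : exact f g -> g ∘ f = 0.
Proof. by case=> [k [e [i [_ [gi _] ->]]]]; rewrite compA gi comp0m. Qed.

Lemma has_zero : exists z : C, is_zero z.
Proof.
have [z [inj univ]] := has_coproducts abC (fun i : void => match i with end).
have z0 t (f : hom z t) : f = 0.
  have [h [_ uniq]] := univ t (fun i : void => match i with end).
  by rewrite -(uniq f) ?(uniq 0) // => -[].
by exists z => t; split=> f; [exact: z0 | rewrite -[f]comp1m (z0 _ (idm z)) comp0m].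
Qed.

Lemma zero_projective z : is_zero z -> projective z.
Proof. by move=> z0 a b e f _; exists 0; rewrite compm0 ((z0 b).1 f). Qed.

Lemma ses_to_zero a b z (f : hom a b) :
  is_zero z -> mono f -> epi f -> ses f (0 : hom b z).
Proof.
move=> z0 mf ef; apply: (elem_ses abC epC) => [x u px||x v px _|x w px].
- exact: mono_eq0 mf.
- exact: comp0m.
- exact: px _ _ f v ef.
by exists 0; rewrite compm0 ((z0 x).2 w).
Qed.

Lemma ses_from_zero z b : is_zero z -> ses (0 : hom z b) (idm b).
Proof.
move=> z0; apply: (elem_ses abC epC) => [x u px _||x v px|x w px].
- exact: (z0 x).2.
- exact: compm0.
- by rewrite comp1m => ->; exists 0; rewrite comp0m.
by exists w; rewrite comp1m.
Qed.

Lemma idm_mono a : mono (idm a).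
Proof. by move=> t u v; rewrite !comp1m. Qed.

Lemma idm_epi a : epi (idm a).
Proof. by move=> t u v; rewrite !compm1. Qed.

(** Exact complexes are assembled from short exact sequences, where [im m] is to
    be the image of the differential that lands in degree [m]. Exactness of maps
    to [y] then amounts to extending maps from images to the whole degree. *)
Section Splice.
Variables (im ob : int -> C) (inc : forall m, hom (im m) (ob m)).
Variable pro : forall m : int, hom (ob (1 + m)) (im m).
Hypothesis incpro : forall m : int, ses (inc (1 + m)) (pro m).

Lemma inc_mono m : mono (inc m).
Proof.
have -> : m = 1 + (m - 1) by rewrite addrC subrK.
exact: ses_mono (incpro _).
Qed.

Definition splice_complex : exact_complex C :=
  @ExactComplex C ob (fun m => inc m ∘ pro m)
    (fun m => exact_factor (ses_epi (incpro (1 + m))) (incpro m) (@inc_mono m)).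

Lemma splice_cycle m : is_cycle (im (1 + m)) splice_complex.
Proof.
exists m, (inc (1 + m)); have S := incpro m; split=> [|t v] /=.
  by rewrite -compA (ses_comp S) compm0.
by rewrite -compA => /(mono_eq0 (@inc_mono m)); apply: (ses_kernel_of S).2.
Qed.

Lemma splice_hom_exact y :
  (forall m, extS0 0 (im m) y) -> hom_exact splice_complex y.
Proof.
move=> E m f /= fd.
have fi : f ∘ inc (1 + m) = 0.
  by apply: (epi_eq0 (ses_epi (incpro (1 + m)))); rewrite -compA.
have [u uE] := ses_desc (incpro m) fi.
have ext m' (v : hom (im m') y) : exists w, w ∘ inc m' = v.
  have [m'' mE] : exists m'', m' = 1 + m''.
    by exists (m' - 1); rewrite addrC subrK.
  by move: v; rewrite {}mE => v; apply: E (incpro m'') v.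
have [w wE] := ext m u.
by exists w; rewrite compA wE.
Qed.

End Splice.

Variables X Y : set C.
Hypothesis hXY : GP_admissible X Y.

Definition perpY M := forall y, Y y -> forall n, extS0 n M y.

Lemma projective_XY p : projective p -> X p /\ Y p.
Proof. by move=> pp; have : Proj C p by []; rewrite -(adm_Proj hXY). Qed.

Lemma X_perpY x : X x -> perpY x.
Proof.
move=> Xx y Yy n; apply/(Ext_eq0_extS0 abC epC).
exact: adm_perp hXY _ _ _ Xx Yy _.
Qed.

Lemma projective_perpY p : projective p -> perpY p.
Proof. by move=> pp y _ n; exact: extS0_projective. Qed.

Lemma perpY_extension a b c (f : hom a b) (g : hom b c) :
  ses f g -> perpY a -> perpY c -> perpY b.
Proof.
move=> S pa pc y Yy n.
by apply: (extS0_extension abC epC S); [apply: pa | apply: pc].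
Qed.

Lemma perpY_kernel a b c (f : hom a b) (g : hom b c) :
  ses f g -> perpY b -> perpY c -> perpY a.
Proof.
move=> S pb pc y Yy n.
by apply: (extS0_kernel abC epC S); [apply: pb | apply: pc].
Qed.

(** [Gproj] is the greatest [coresolving] class: the objects that have a
    coresolution by projective objects with all cocycles left orthogonal to [Y].
    Membership is shown by exhibiting any coresolving class, which avoids
    infinite constructions, and [GP_Gproj] and [Gproj_GP] show that these are
    exactly the relative Gorenstein projective objects. *)
Definition coresolving (T : set C) : Prop := forall M, T M -> perpY M /\
  exists w M' (f : hom M w) (g : hom w M'), [/\ projective w, ses f g & T M'].

Definition Gproj M : Prop := exists T, coresolving T /\ T M.

Lemma Gproj_coresolving : coresolving Gproj.
Proof.
move=> M [T [cT TM]]; have [pM [w [M' [f [g [pw S TM']]]]]] := cT _ TM.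
by split=> //; exists w, M', f, g; split=> //; exists T.
Qed.

Lemma Gproj_perpY M : Gproj M -> perpY M.
Proof. by move/Gproj_coresolving => -[]. Qed.

Lemma Gproj_projective p : projective p -> Gproj p.
Proof.
move=> pp; exists (Proj C); split=> // M pM.
split; first exact: projective_perpY.
have [z z0] := has_zero.
exists M, z, (idm M), 0; split=> //; last exact: zero_projective.
by apply: ses_to_zero => //; [exact: idm_mono | exact: idm_epi].
Qed.

(** The pushout of [a -> b] along an embedding of [a] into a projective object
    [w] splits over [c], because [w] lies in [Y]. So it embeds into the sum of
    [w] and of a projective object containing [c]. *)
Lemma Gproj_extension a b c (f : hom a b) (g : hom b c) :
  ses f g -> Gproj a -> Gproj c -> Gproj b.
Proof.
move=> S Ga Gc.
exists (fun b => exists a c (f : hom a b) (g : hom b c),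
  [/\ ses f g, Gproj a & Gproj c]); split; last by exists a, c, f, g.
move=> {a b c f g S Ga Gc} b [a [c [f [g [S Ga Gc]]]]].
split.
  by apply: perpY_extension S _ _; apply: Gproj_perpY.
have [_ [wa [a' [fa [ga [pwa Sa Ga']]]]]] := Gproj_coresolving Ga.
have [pc [wc [c' [fc [gc [pwc Sc Gc']]]]]] := Gproj_coresolving Gc.
have [t [f' [g' [h' [k' [S' T' _ _ _]]]]]] := pushout_ses abC epC S Sa.
have [r rf] := pc wa (projective_XY pwa).2 0%N _ _ _ _ S' (idm wa).
have [s [il [ir [pl [pr B]]]]] := has_biproduct abC wa wc.
pose j := il ∘ r + ir ∘ (fc ∘ g').
have plj : pl ∘ j = r.
  by rewrite compDr !compA (pl_il B) (pl_ir B) !comp0m addr0 comp1m.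
have prj : pr ∘ j = fc ∘ g'.
  by rewrite compDr !compA (pr_il B) (pr_ir B) !comp0m add0r comp1m.
have U : ses j (gc ∘ pr).
  apply: (elem_ses abC epC) => [x u px ju||x v px|x w px].
  - have ru : r ∘ u = 0 by rewrite -plj -compA ju compm0.
    have gu : g' ∘ u = 0.
      by apply: (mono_eq0 (ses_mono Sc)); rewrite compA -prj -compA ju compm0.
    have [v vE] := ses_lift S' gu.
    by move: ru; rewrite -vE compA rf comp1m => ->; rewrite compm0.
  - by rewrite -compA prj compA (ses_comp Sc) comp0m.
  - rewrite -compA => /(ses_lift Sc)[z zE].
    have [t0 t0E] := px _ _ g' z (ses_epi S').
    exists (t0 + f' ∘ (pl ∘ v - r ∘ t0)).
    rewrite -[RHS]comp1m -(il_ir B) compDl /j compDl -!compA -zE; congr (_ + _).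
      by rewrite compDr (compA r f') rf comp1m addrC subrK.
    by rewrite compDr (compA g' f') (ses_comp S') comp0m addr0 t0E.
  have [v <-] := px _ _ gc w (ses_epi Sc).
  by exists (ir ∘ v); rewrite -compA (compA pr) (pr_ir B) comp1m.
have [b' [q [m [l [V W _ _]]]]] := composite_ses abC epC T' U.
exists s, b', (j ∘ h'), q; split=> //; first exact: biproduct_projective B _ _.
by exists a', c', m, l.
Qed.

(** ** Cycles of totally acyclic complexes *)

Section Cycles.
Variable K : exact_complex C.
Hypotheses (XK : forall m, X (K m)) (hK : forall y, Y y -> hom_exact K y).

Lemma cycle_ses m M M' (i : hom M (K (1 + (1 + m)))) (i' : hom M' (K (1 + m))) :
  is_kernel i (cx_d K (1 + m)) -> is_kernel i' (cx_d K m) ->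
  exists e, ses i e /\ cx_d K (1 + m) = i' ∘ e.
Proof.
move=> Ki Ki'; have [e [ee dE]] := exact_kernel (cx_exact K m) Ki'.
exists e; split=> //; apply: kernel_ses => //; split=> [|t v ev].
  by apply: (mono_eq0 (kernel_mono Ki')); rewrite compA -dE Ki.1.
by apply: Ki.2; rewrite dE -compA ev compm0.
Qed.

(** In degree one the orthogonality is the exactness of the complex of maps to
    [y]; higher degrees are shifted along the complex. *)
Lemma cycle_perpY m M (i : hom M (K (1 + m))) :
  is_kernel i (cx_d K m) -> perpY M.
Proof.
move=> Ki y Yy n; elim: n m M i Ki => [|n IH] m M i Ki.
all: have [M1 [i1 K1]] := has_kernels abC (cx_d K (1 + m)).
all: have [e [S dE]] := cycle_ses K1 Ki.
all: have EK := X_perpY (XK (1 + (1 + m))) Yy.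
  have [M2 [i2 K2]] := has_kernels abC (cx_d K (1 + (1 + m))).
  have [e1 [S1 dE1]] := cycle_ses K2 K1.
  apply: (ext1_quotient abC epC S) (EK 0%N) => u.
  have e1d : e1 ∘ cx_d K (1 + (1 + (1 + m))) = 0.
    apply: (mono_eq0 (kernel_mono K1)).
    by rewrite compA -dE1 (exact_comp0 (cx_exact K _)).
  have [|v vE] := hK Yy (m := 1 + (1 + m)) (f := u ∘ e1).
    by rewrite -compA e1d compm0.
  by exists v; apply: (ses_epi S1); rewrite vE dE1 compA.
by apply: (extS0_quotient abC epC S) (EK _); apply: IH K1.
Qed.

(** Cycles only embed into objects of [X]. Embedding these further into
    projective objects leads to extensions of objects of [X] by cycles, and
    this class is coresolving. *)
Lemma cycle_Gproj M : is_cycle M K -> Gproj M.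
Proof.
move=> cM; have [z z0] := has_zero.
exists (fun b => exists a c (f : hom a b) (g : hom b c),
  [/\ ses f g, is_cycle a K & X c]); split; last first.
  exists M, z, (idm M), 0; split=> //.
    by apply: ses_to_zero => //; [exact: idm_mono | exact: idm_epi].
  exact: (projective_XY (zero_projective z0)).1.
move=> {M cM z z0} b [a [c [f [g [S [m [i Ki]] Xc]]]]].
split; first exact: perpY_extension S (cycle_perpY Ki) (X_perpY Xc).
have [m' mE] : exists m', m = 1 + m' by exists (m - 1); rewrite addrC subrK.
subst m; have [a' [i' Ki']] := has_kernels abC (cx_d K m').
have [e [T _]] := cycle_ses Ki Ki'.
have [t [f' [g' [h' [k' [S' T' _ _ _]]]]]] := pushout_ses abC epC S T.
have Xt : X t by apply: adm_extX hXY _ _ _ _ _ (ses_short S') (XK _) Xc.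
have [w [x [j [q [/(short_ses abC) U XYw Xx]]]]] := adm_cogen hXY Xt.
have [b' [r [l [l' [V W _ _]]]]] := composite_ses abC epC T' U.
exists w, b', (j ∘ h'), r; split=> //; first by rewrite (adm_Proj hXY) in XYw.
by exists a', x, l, l'; split=> //; exists m', i'.
Qed.

End Cycles.

Lemma GP_Gproj M : GP X Y M -> Gproj M.
Proof. by case=> K [XK hK cM]; apply: cycle_Gproj cM. Qed.

(** ** A totally acyclic complex through a given object *)

Record cocover M := Cocover {
  cocover_obj : C;
  cocover_coker : C;
  cocover_map : hom M cocover_obj;
  cocover_out : hom cocover_obj cocover_coker;
  cocover_proj : projective cocover_obj;
  cocover_ses : ses cocover_map cocover_out;
  cocover_Gproj : Gproj cocover_coker
}.

Lemma choose_cocover M : Gproj M -> cocover M.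
Proof.
move/Gproj_coresolving => -[_].
move=> /cid[w /cid[M' /cid[f /cid[g [pw S GM']]]]].
exact: Cocover pw S GM'.
Qed.

Section CompleteResolution.
Variables (M : C) (GM : Gproj M).

Definition next_cosyzygy (N : {N | Gproj N}) : {N | Gproj N} :=
  exist _ _ (cocover_Gproj (choose_cocover (proj2_sig N))).

Fixpoint cosyzygies m : {N | Gproj N} :=
  if m is m'.+1 then next_cosyzygy (cosyzygies m') else exist _ M GM.

Definition right_half m := choose_cocover (proj2_sig (cosyzygies m)).
Definition left_half m := choose_cover abC epC (syzygies abC epC M m).

(** The projective resolution of [M] sits in degrees [m >= 0] and its
    coresolution in negative degrees, so that [M] itself is the image of the
    differential that lands in degree [-1]. *)
Definition total_im (m : int) : C :=
  match m with
  | Posz j => cover_ker (left_half j)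
  | Negz j => proj1_sig (cosyzygies j)
  end.

Definition total_ob (m : int) : C :=
  match m with
  | Posz j => cover_obj (left_half j)
  | Negz j => cocover_obj (right_half j)
  end.

Definition total_inc (m : int) : hom (total_im m) (total_ob m) :=
  match m with
  | Posz j => cover_in (left_half j)
  | Negz j => cocover_map (right_half j)
  end.

(* Negative degrees are split far enough for [1 + m] to compute. *)
Definition total_pro (m : int) : hom (total_ob (1 + m)) (total_im m) :=
  match m with
  | Posz j => cover_map (left_half j.+1)
  | Negz 0 => cover_map (left_half 0)
  | Negz 1 => cocover_out (right_half 0)
  | Negz j.+2 => cocover_out (right_half j.+1)
  end.

Lemma total_ses (m : int) : ses (total_inc (1 + m)) (total_pro m).
Proof.
case: m => [j|[|[|j]]].
- exact: cover_ses (left_half j.+1).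
- exact: cover_ses (left_half 0).
- exact: cocover_ses (right_half 0).
exact: cocover_ses (right_half j.+1).
Qed.

Lemma total_im_perpY m : perpY (total_im m).
Proof.
have Gc j : perpY (proj1_sig (cosyzygies j)).
  exact: Gproj_perpY (proj2_sig (cosyzygies j)).
case: m => [j|j]; last exact: Gc.
have step M' (c : cover M') : perpY M' -> perpY (cover_ker c).
  exact: perpY_kernel (cover_ses c) (projective_perpY (@cover_proj _ _ c)).
elim: j => [|j IH] /=; apply: step; last exact: IH.
exact: Gc 0%N.
Qed.

Lemma total_ob_projective m : projective (total_ob m).
Proof.
by case: m => j; [exact: cover_proj | exact: cocover_proj].
Qed.

Lemma Gproj_GP : GP X Y M.
Proof.
exists (splice_complex total_ses); split=> [m|y Yy|].
- exact: (projective_XY (@total_ob_projective m)).1.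
- by apply: splice_hom_exact => m; apply: total_im_perpY.
exact: (splice_cycle total_ses (Negz 1)).
Qed.

End CompleteResolution.

(** * Dimensions *)

Fixpoint Gdim_le n M : Prop :=
  match n with
  | 0%N => Gproj M
  | n.+1 => exists k g (i : hom k g) (e : hom g M),
      [/\ Gproj g, ses i e & Gdim_le n k]
  end.

Lemma Gdim_leS n M : Gdim_le n M -> Gdim_le n.+1 M.
Proof.
elim: n M => [|n IH] M GM.
  have [z z0] := has_zero; exists z, M, 0, (idm M); split=> //.
    exact: ses_from_zero.
  exact: Gproj_projective (zero_projective z0).
have [k [g [i [e [Gg S Gk]]]]] := GM.
by exists k, g, i, e; split=> //; apply: IH.
Qed.

Lemma Gdim_leW m n M : (m <= n)%N -> Gdim_le m M -> Gdim_le n M.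
Proof.
by move/subnK <-; elim: (n - m)%N => //= d IH /IH; apply: Gdim_leS.
Qed.

Lemma Gdim_le_resolution n M : Gdim_le n M <-> exists G : resolution M,
  (forall i, (i <= n)%N -> GP X Y (G i)) /\
  (forall i, (n < i)%N -> is_zero (G i)).
Proof.
split.
  elim: n M => [|n IH] M.
    move=> GM; have [z z0] := has_zero.
    have zz (m : nat) : ses (0 : hom z z) (0 : hom z z).
      by have := ses_from_zero z z0; rewrite ((z0 z).1 (idm z)).
    pose R := ses_resolution zz.
    exists (cons_resolution (ses_from_zero M z0) R); split=> -[|i] // _.
    exact: Gproj_GP.
  case=> k [g [i [e [Gg S /IH[R [GR R0]]]]]].
  exists (cons_resolution S R); split=> -[|j] //; last exact: R0.
    by move=> _; apply: Gproj_GP.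
  exact: GR.
elim: n M => [|n IH] M [R [GR R0]];
  have [k [i [e [S ee dE]]]] := tail_exists abC R.
  have k0 : idm k = 0.
    by apply: (epi_eq0 ee); rewrite comp1m; apply: (R0 1%N isT _).1.
  have ma : mono (res_aug R).
    apply: mono_intro => t u /(ses_lift S)[v <-].
    by rewrite -[v]comp1m k0 comp0m compm0.
  have [z z0] := has_zero.
  apply: (Gproj_extension (ses_to_zero z0 ma (ses_epi S))).
    exact/GP_Gproj/GR.
  exact: Gproj_projective (zero_projective z0).
exists k, (R 0%N), i, (res_aug R); split=> //; first exact/GP_Gproj/GR.
by apply: IH; exists (tail_resolution S ee dE); split=> j; [exact: (GR j.+1) | exact: (R0 j.+1)].
Qed.

Lemma Gdim_extS0 n M y j : Gdim_le n M -> Y y -> (n <= j)%N -> extS0 j M y.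
Proof.
move=> GM Yy; elim: n M GM j => [|n IH] M; first by move/Gproj_perpY => + j _; apply.
case=> k [g [i [e [Gg S Gk]]]] [|j] // nj.
apply: (extS0_quotient abC epC S); first exact: IH.
exact: Gproj_perpY Gg _ Yy _.
Qed.

Definition pd_le n M := forall j N, (n <= j)%N -> extS0 j M N.

Lemma pd_le_projective M : pd_le 0 M -> projective M.
Proof.
move=> E; have [k [p [i [e [pp S]]]]] := projective_cover abC epC M.
have [r ri] := E 0%N k isT _ _ _ _ S (idm k).
have [s es] := ses_retraction S ri.
exact: retract_projective es pp.
Qed.

Lemma pd_le_kernel n k p M (i : hom k p) (e : hom p M) :
  projective p -> ses i e -> pd_le n.+1 M -> pd_le n k.
Proof. by move=> pp S E j N nj; apply: (E j.+1 N nj _ _ _ _ pp S). Qed.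

Lemma pd_le_cokernel n k p M (i : hom k p) (e : hom p M) :
  projective p -> ses i e -> pd_le n k -> pd_le n.+1 M.
Proof.
move=> pp S E [|j] N // nj.
by apply: (extS0_syzygy abC epC pp S); apply: E.
Qed.

(** In the induction step the kernel [k] of [g0 -> M] embeds into its hull [h].
    The pushout [t] of [g0] and [h] is an extension of objects of [Gproj], so it
    embeds into a projective object [w], and the hull of [M] is [w] modulo [h]. *)
Lemma Gdim_hull n M : Gdim_le n M -> exists h g (f : hom M h) (q : hom h g),
  [/\ ses f q, pd_le n h & Gproj g].
Proof.
elim: n M => [|n IH] M.
  case/Gproj_coresolving => _ [w [M' [f [g [pw S GM']]]]].
  exists w, M', f, g; split=> // j N _.
  exact: extS0_projective.
case=> k [g0 [i [e [Gg0 S /IH[h [g1 [f [q [T ph Gg1]]]]]]]]].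
have [t [f' [g' [h' [k' [S' T' _ _ _]]]]]] := pushout_ses abC epC S T.
have [_ [w [t' [j [l [pw U Gt']]]]]] :=
  Gproj_coresolving (Gproj_extension T' Gg0 Gg1).
have [h2 [r [x [y [V W _ _]]]]] := composite_ses abC epC S' U.
exists h2, t', x, y; split=> //.
exact: pd_le_cokernel pw V ph.
Qed.

(** An injective object splits off from its hull. *)
Lemma Gdim_injective n q : injective_object q -> Gdim_le n q -> pd_le n q.
Proof.
move=> iq /Gdim_hull[h [g [f [l [S ph _]]]]] j N nj.
have [r rf] := iq _ _ f (idm q) (ses_mono S).
by apply: (extS0_retract abC epC rf); apply: ph.
Qed.

(** A finite projective dimension is detected by projective coefficients: the
    last syzygy [k] is projective, and if the top Ext group with values in [k]
    vanishes then [k] splits off. *)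
Lemma pd_le_drop n M :
  pd_le n.+1 M -> (forall p, projective p -> extS0 n M p) -> pd_le n M.
Proof.
elim: n M => [|n IH] M pM E.
  have [k [p [i [e [pp S]]]]] := projective_cover abC epC M.
  have pk : projective k by apply/pd_le_projective/(pd_le_kernel pp S).
  have [r ri] := E k pk _ _ _ _ S (idm k).
  have [s es] := ses_retraction S ri.
  by move=> j N _; apply: extS0_projective (retract_projective es pp).
have [k [p [i [e [pp S]]]]] := projective_cover abC epC M.
apply: (pd_le_cokernel pp S); apply: IH; first exact: pd_le_kernel pp S pM.
by move=> p' pp'; apply: E pp' _ _ _ _ pp S.
Qed.

Lemma pd_le_descend m n M :
  (forall p, projective p -> forall j, (m <= j)%N -> extS0 j M p) ->
  pd_le n M -> pd_le m M.
Proof.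
move=> E; elim: n => [|n IH] pM; first by move=> j N _; apply: pM.
case: (leqP m n) => [mn|nm].
  by apply/IH/pd_le_drop => // p pp; apply: E.
by move=> j N mj; apply: pM; apply: leq_trans mj.
Qed.

(** ** Syzygies of all objects *)

Fixpoint syzygy n M K : Prop :=
  match n with
  | 0%N => M = K
  | n.+1 => exists k p (i : hom k p) (e : hom p M),
      [/\ projective p, ses i e & syzygy n k K]
  end.

Lemma syzygy_exists n M : exists K, syzygy n M K.
Proof.
elim: n M => [|n IH] M; first by exists M.
have [k [p [i [e [pp S]]]]] := projective_cover abC epC M.
by have [K] := IH k; exists K, k, p, i, e.
Qed.

Lemma syzygy_Gdim n M K : syzygy n M K -> Gproj K -> Gdim_le n M.
Proof.
elim: n M => [|n IH] M /=; first by move=> ->.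
case=> k [p [i [e [pp S KK]]]] GK; exists k, p, i, e; split=> //.
  exact: Gproj_projective.
exact: IH.
Qed.

(** Taking syzygies of [0 -> M -> I -> Z -> 0] by the horseshoe lemma turns the
    middle term into a projective object. *)
Lemma syzygy_embed n M q Z K (f : hom M q) (g : hom q Z) :
  ses f g -> pd_le n q -> syzygy n M K ->
  exists w K' (f' : hom K w) (g' : hom w K'),
    [/\ projective w, ses f' g' & syzygy n Z K'].
Proof.
elim: n M q Z f g => [|n IH] M q Z f g S pq /=.
  by move=> <-; exists q, Z, f, g; split=> //; apply: pd_le_projective.
case=> k [p [i [e [pp T KK]]]].
have [kc [c [ic [ec [pc Tc]]]]] := projective_cover abC epC Z.
have [s [il [ir [pl [pr [kb [ib [eb [fk [gk [B Tb U _ _]]]]]]]]]]] :=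
  horseshoe abC epC S T Tc pc.
have pkb := pd_le_kernel (biproduct_projective B pp pc) Tb pq.
have [w [K' [f' [g' [pw V KK']]]]] := IH _ _ _ _ _ U pkb KK.
by exists w, K', f', g'; split=> //; exists kc, c, ic, ec.
Qed.

(** Embedding into injective objects of projective dimension at most [n] embeds
    each [n]-th syzygy into a projective object with another [n]-th syzygy as
    cokernel. Repeating this [d] times shows each [n]-th syzygy to be a [d]-th
    syzygy of some object, for every [d], so that a finite bound on the injective
    dimensions over [Y] makes all its Ext groups into [Y] vanish. *)
Lemma syzygy_Gproj n m M K : enough_injectives C ->
  (forall q, injective_object q -> pd_le n q) ->
  (forall y, Y y -> forall j N, (m <= j)%N -> extS0 j N y) ->
  syzygy n M K -> Gproj K.
Proof.
move=> eiC pdI idY MK; exists (fun K => exists M, syzygy n M K).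
split; last by exists M.
have embed M' K' : syzygy n M' K' -> exists w K'' (f : hom K' w) (g : hom w K''),
    [/\ projective w, ses f g & exists Z, syzygy n Z K''].
  move=> MK'; have [q [f [iq mf]]] := eiC M'.
  have [Z [g S]] := ses_cokernel abC mf.
  have [w [K'' [f' [g' [pw T ZK]]]]] := syzygy_embed S (pdI _ iq) MK'.
  by exists w, K'', f', g'; split=> //; exists Z.
move=> {M K MK} K [M MK]; split; last exact: embed MK.
move=> y Yy j; have : (m <= j + m)%N by apply: leq_addl.
move: {2}m => d; elim: d j M K MK => [|d IH] j M K MK mj.
  by apply: idY => //; rewrite addn0 in mj.
have [w [K' [f [g [pw S [Z ZK']]]]]] := embed _ _ MK.
apply: (extS0_kernel abC epC S); first exact: extS0_projective.
by apply: IH ZK' _; rewrite addSnnS.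
Qed.

(** ** The numerical invariants *)

Lemma Gpd_le n M : (Gpd X Y M <= Fin n)%enat <-> Gdim_le n M.
Proof.
split=> [/least_le[j [jn /Gdim_le_resolution]]|GM]; first exact: Gdim_leW.
by apply/least_le; exists n; split=> //; apply/Gdim_le_resolution.
Qed.

Lemma glGPD_le n : (glGPD X Y <= Fin n)%enat <-> forall M, Gdim_le n M.
Proof.
split=> [/esup_le H M|H]; first by apply/Gpd_le/H; exists M.
by apply/esup_le => _ [M _ <-]; apply/Gpd_le.
Qed.

Lemma pd_class_le (S : set C) n :
  (pd_class S <= Fin n)%enat <-> forall M, S M -> pd_le n M.
Proof.
split=> [/esup_le H M SM j N nj|H].
  have /least_le[m [mn E]] : (pd M <= Fin n)%enat by apply: H; exists M.
  by apply/(Ext_eq0_extS0 abC epC)/E; apply: leq_trans nj.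
apply/esup_le => _ [M SM <-]; apply/least_le; exists n; split=> // -[|j] // nj N.
by apply/(Ext_eq0_extS0 abC epC)/H.
Qed.

Lemma id_class_le (S : set C) n : (id_class S <= Fin n)%enat <->
  forall y, S y -> forall j N, (n <= j)%N -> extS0 j N y.
Proof.
split=> [/esup_le H y Sy j N nj|H].
  have /least_le[m [mn E]] : (id_ y <= Fin n)%enat by apply: H; exists y.
  by apply/(Ext_eq0_extS0 abC epC)/E; apply: leq_trans nj.
apply/esup_le => _ [y Sy <-]; apply/least_le; exists n; split=> // -[|j] // nj N.
by apply/(Ext_eq0_extS0 abC epC)/H.
Qed.

(** Objects of [Gproj] are orthogonal to [Y], which bounds the injective
    dimensions, and the hulls of injective objects bound the projective ones. *)
Lemma glGPD_bounds n : (glGPD X Y <= Fin n)%enat ->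
  (pd_class (Inj C) <= Fin n)%enat /\ (id_class Y <= Fin n)%enat.
Proof.
move/glGPD_le => GL; split.
  by apply/pd_class_le => q iq; apply: Gdim_injective.
by apply/id_class_le => y Yy j N nj; apply: Gdim_extS0 nj.
Qed.

Lemma glGPD_le_pd n m : enough_injectives C ->
  (pd_class (Inj C) <= Fin n)%enat -> (id_class Y <= Fin m)%enat ->
  (glGPD X Y <= Fin n)%enat.
Proof.
move=> eiC /pd_class_le pdI /id_class_le idY; apply/glGPD_le => M.
have [K MK] := syzygy_exists n M.
exact: syzygy_Gdim MK (syzygy_Gproj eiC pdI idY MK).
Qed.

(** Projective objects belong to [Y], so the bound [m] on injective dimensions
    applies to the coefficients that detect projective dimension. *)
Lemma pd_Inj_le_id n m :
  (pd_class (Inj C) <= Fin n)%enat -> (id_class Y <= Fin m)%enat ->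
  (pd_class (Inj C) <= Fin m)%enat.
Proof.
move=> /pd_class_le pdI /id_class_le idY; apply/pd_class_le => q iq.
apply: pd_le_descend (pdI q iq) => p pp j mj.
exact: idY (projective_XY pp).2 _ _ mj.
Qed.

End Gorenstein.

Theorem proposition3p7 (A : preadditive) (abA : abelian A)
    (hP : enough_projectives A) (hI : enough_injectives A)
    (X Y : set A) (hXY : GP_admissible X Y) (n : nat) :
  ((glGPD X Y <= Fin n /\ Fin n < Infty)%enat <->
   (pd_class (Inj A) <= Fin n /\ id_class Y < Infty)%enat)
  /\
  (glGPD X Y = Fin n <->
   (pd_class (Inj A) <= Fin n /\ Fin n <= id_class Y /\
    id_class Y < Infty)%enat).
Proof.
have bounds := glGPD_bounds abA hP hXY.
have bounded j m := @glGPD_le_pd _ abA hP _ _ hXY j m hI.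
have pd_id := pd_Inj_le_id abA hP hXY.
split; split.
- by move=> [/bounds[pdI]]; case: (id_class Y) => // m _ _.
- case=> pdI []; case Ym: (id_class Y) => [m|] // _ _; split=> //.
  by apply: (bounded n m) => //; rewrite Ym /=.
- move=> gln; have [|pdI idY] := bounds n; first by rewrite gln /=.
  case Ym: (id_class Y) idY => [m|] // mn; split=> //; split=> //.
  have idY : (id_class Y <= Fin m)%enat by rewrite Ym /=.
  by have := bounded m m (pd_id _ _ pdI idY) idY; rewrite gln.
case=> pdI [nid []]; case Ym: (id_class Y) nid => [m|] // nm _ _.
have idY : (id_class Y <= Fin m)%enat by rewrite Ym /=.
have := bounded n m pdI idY.
case glk: (glGPD X Y) => [k|] // kn.
have [|_] := bounds k; first by rewrite glk /=.
rewrite Ym => mk; congr Fin; apply/eqP; rewrite eqn_leq kn.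
exact: leq_trans nm mk.
Qed.
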